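(* Let $\alpha:T_1\to T_2$ be a monomorphism of directed trees, let $\alpha_*:A(T_1)\to A(T_2)$ be the induced injective $*$-homomorphism, and let $S_2\subseteq\Sigma(T_2)$. Let $\pi_2:A(T_2)\to A(T_2,S_2)$ be the quotient (restriction) map, and let $$S_1=\bigl\{v\in\Sigma(T_1)\;\bigm|\;\alpha(v)\in S_2\text{ and }\alpha\bigl(\Delta_{1,T_1}(v)\bigr)=\Delta_{1,T_2}\bigl(\alpha(v)\bigr)\bigr\}.$$ Then $\ker(\pi_2\circ\alpha_* )=C_0(S_1)$, so that there is a commutative diagram $$\begin{array}{ccc}A(T_1)&\xrightarrow{\ \alpha_*\ }&A(T_2)\\ \downarrow&&\downarrow{\scriptstyle\pi_2}\\ A(T_1,S_1)&\longrightarrow&A(T_2,S_2)\end{array}$$ with surjective columns (given by restrictions) and injective rows.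
   Context: A graph $T$ consists of a set $T^0$ of vertices, a set $T^1$ of edges, maps $o,t:T^1\to T^0$, and a reversal $e\mapsto\overline e$ on $T^1$ with $\overline{\overline e}=e$, $\overline e\ne e$, $o(\overline e)=t(e)$. A directed graph is a graph with a subset $T^1_+\subseteq T^1$ containing exactly one edge from each pair $\{e,\overline e\}$. (No finiteness or countability assumptions.) A path is a sequence $e_1e_2\cdots$ of edges with $t(e_{i-1})=o(e_i)$ and $e_i\ne\overline{e_{i-1}}$ for $i>1$; vertices are paths of length $0$; it is directed if all $e_i\in T^1_+$ (length-zero paths are directed). $T^*$ (resp. $T^*_+$) is the set of finite (resp. finite directed) paths. $T$ is a tree if for all $u,v\in T^0$ there is a unique $p\in T^*$ with $o(p)=u$, $t(p)=v$. A morphism of directed graphs is a pair of maps on vertices and on edges intertwining $o$, $t$ and reversal and mapping directed edges to directed edges; it is a monomorphism if it is injective on vertices and on edges. For $v\in T^0$: $\Delta_{1,T}(v)=\{e\in T^1_+: o(e)=v\}$, $V_T(v)=\{t(p):p\in T^*_+,\,o(p)=v\}$, and for finite $F\subseteq\Delta_{1,T}(v)$, $V_T(v;F)=\{v\}\cup\bigcup_{e\in\Delta_{1,T}(v)\setminus F}V_T(t(e))$. $\Sigma(T)=\{u\in T^0:0<\#\Delta_{1,T}(u)<\infty\}$. $\mathcal A(T)$ is the ring of subsets of $T^0$ consisting of finite disjoint unions of sets $V_T(v;F)$ and $\emptyset$; $A(T)\subseteq\ell^\infty(T^0)$ is the closed linear span of $\{\chi_B:B\in\mathcal A(T)\}$,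 a commutative $C^*$-algebra. For $v\in\Sigma(T)$ the singleton $\{v\}=V_T(v;\Delta_{1,T}(v))$ belongs to $\mathcal A(T)$, so $v$ is an isolated point of the spectrum of $A(T)$; for $S\subseteq\Sigma(T)$, $C_0(S)$ is the ideal of $A(T)$ generated by $\{\chi_{\{v\}}:v\in S\}$, and $A(T,S)=A(T)/C_0(S)$. The injective $*$-homomorphism $\alpha_*:A(T_1)\to A(T_2)$ is the one determined by $\chi_{V_{T_1}(v;F)}\mapsto\chi_{V_{T_2}(\alpha(v);\alpha(F))}$. *)

(* Defs.v *)
From HB Require Import structures.
From mathcomp Require Import all_boot all_order all_algebra.
From mathcomp Require Import complex.
From mathcomp Require Import all_classical all_reals numfun.
Set Implicit Arguments.
Unset Strict Implicit.
Unset Printing Implicit Defensive.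
Import Order.TTheory GRing.Theory Num.Theory.
Local Open Scope classical_set_scope.
Local Open Scope ring_scope.
Local Open Scope complex_scope.
Local Open Scope quotient_scope.

Record digraph := Digraph {
  vert : Type;
  edge : Type;
  org : edge -> vert;
  ter : edge -> vert;
  bar : edge -> edge;
  pos : set edge;
  barK : forall e, bar (bar e) = e;
  bar_neq : forall e, bar e <> e;
  org_bar : forall e, org (bar e) = ter e;
  pos_bar : forall e, pos (bar e) <-> ~ pos e }.

(* A path is given by its origin and its list of edges, so that the vertex u,
   as a path of length 0, is the pair of u and [::]. *)
Fixpoint is_path (T : digraph) (u : vert T) (p : seq (edge T)) (v : vert T)
    : Prop :=
  match p with
  | [::] => u = v
  | e :: q => [/\ org e = u,
                  (match q with [::] => True | e' :: _ => e' <> bar e end)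
                & is_path (ter e) q v]
  end.

Definition is_dpath (T : digraph) (u : vert T) (p : seq (edge T)) (v : vert T)
    : Prop :=
  is_path u p v /\ all (fun e => `[< pos e >]) p.

Record ditree := Ditree {
  ditree_digraph :> digraph;
  ditreeP : forall u v : vert ditree_digraph, exists! p, is_path u p v }.

Record dimorphism (T1 T2 : digraph) := Dimorphism {
  mor_vert : vert T1 -> vert T2;
  mor_edge : edge T1 -> edge T2;
  mor_org : forall e, org (mor_edge e) = mor_vert (org e);
  mor_ter : forall e, ter (mor_edge e) = mor_vert (ter e);
  mor_bar : forall e, bar (mor_edge e) = mor_edge (bar e);
  mor_pos : forall e, pos e -> pos (mor_edge e) }.

Definition monomorphism (T1 T2 : digraph) (alpha : dimorphism T1 T2) : Prop :=
  injective (mor_vert alpha) /\ injective (mor_edge alpha).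

Definition Delta1 (T : digraph) (v : vert T) : set (edge T) :=
  [set e | pos e /\ org e = v].

Definition Vset (T : digraph) (v : vert T) : set (vert T) :=
  [set w | exists p, is_dpath v p w].

Definition VsetF (T : digraph) (v : vert T) (F : set (edge T)) : set (vert T) :=
  [set v] `|` \bigcup_(e in Delta1 v `\` F) Vset (ter e).

Definition Sigma (T : digraph) : set (vert T) :=
  [set u | Delta1 u !=set0 /\ finite_set (Delta1 u)].

Definition ring_sets (T : digraph) : set (set (vert T)) :=
  [set B | exists n (v : 'I_n -> vert T) (F : 'I_n -> set (edge T)),
    [/\ forall i, finite_set (F i) /\ F i `<=` Delta1 (v i),
        trivIset setT (fun i => VsetF (v i) (F i))
      & B = \bigcup_i VsetF (v i) (F i)]].

Definition linfty (R : realType) (X : Type) : set (X -> R[i]) :=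
  [set f | exists M : R, forall x, `|f x| <= M%:C].

Definition sup_closure (R : realType) (X : Type) (E : set (X -> R[i]))
    : set (X -> R[i]) :=
  [set f | forall eps : R, 0 < eps ->
     exists2 g, E g & forall x, `|f x - g x| <= eps%:C].

Definition simple_span (R : realType) (T : digraph) : set (vert T -> R[i]) :=
  [set f | exists n (c : 'I_n -> R[i]) (B : 'I_n -> set (vert T)),
     (forall i, ring_sets (B i)) /\ f = \sum_(i < n) c i *: \1_(B i)].
Arguments simple_span : clear implicits.

Definition AT_pred (R : realType) (T : digraph) : {pred vert T -> R[i]} :=
  [pred f | `[< linfty f /\ sup_closure (simple_span R T) f >]].
Arguments AT_pred : clear implicits.

(* Star-algebras over C, possibly without unit: A(T) has a unit only when T^0
   itself belongs to the ring of sets. *)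
HB.mixin Record Lmodule_isStarAlgebra (C : numClosedFieldType) V
    of GRing.Lmodule C V := {
  smul : V -> V -> V;
  star : V -> V;
  smulA : associative smul;
  smulDl : left_distributive smul +%R;
  smulDr : right_distributive smul +%R;
  smulZl : forall (a : C) (x y : V), smul (a *: x) y = a *: smul x y;
  smulZr : forall (a : C) (x y : V), smul x (a *: y) = a *: smul x y;
  starK : involutive star;
  starD : forall x y : V, star (x + y) = star x + star y;
  starZ : forall (a : C) (x : V), star (a *: x) = a^* *: star x;
  starM : forall x y : V, star (smul x y) = smul (star y) (star x) }.

#[short(type="starAlgType")]
HB.structure Definition StarAlgebra (C : numClosedFieldType) :=
  { V of Lmodule_isStarAlgebra C V & GRing.Lmodule C V }.

Section StarAlgebraTheory.
Variables (C : numClosedFieldType) (V : starAlgType C).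
Implicit Types x y : V.

Lemma smulrN x y : smul x (- y) = - smul x y.
Proof. by rewrite -(scaleN1r y) smulZr scaleN1r. Qed.

Lemma smulNr x y : smul (- x) y = - smul x y.
Proof. by rewrite -(scaleN1r x) smulZl scaleN1r. Qed.

Lemma starN x : star (- x) = - star x.
Proof. by rewrite -(scaleN1r x) starZ rmorphN1 scaleN1r. Qed.

End StarAlgebraTheory.

Definition star_hom (C : numClosedFieldType) (A B : starAlgType C)
    (phi : {linear A -> B}) : Prop :=
  (forall x y : A, phi (smul x y) = smul (phi x) (phi y)) /\
  (forall x : A, phi (star x) = star (phi x)).

Section SimpleSpan.
Variables (R : realType).
Local Notation C := R[i].

Section Graph.
Variable T : digraph.
Implicit Types (f g : vert T -> C) (v w : vert T).
Local Notation span := (simple_span R T).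

Lemma span0 : span 0.
Proof.
exists 0%N, (fun=> 0), (fun=> set0); split; first by case.
by rewrite big_ord0.
Qed.

Lemma spanD f g : span f -> span g -> span (f + g).
Proof.
move=> [n [c [B [hB ->]]]] [m [d [D [hD ->]]]].
exists (n + m)%N, (fun i => match fintype.split i with inl j => c j | inr j => d j end),
  (fun i => match fintype.split i with inl j => B j | inr j => D j end); split.
  by move=> i; case: (fintype.split i).
rewrite big_split_ord /=; congr (_ + _); apply: eq_bigr => i _.
  by have := unsplitK (inl i : 'I_n + 'I_m) => /= ->.
by have := unsplitK (inr i : 'I_n + 'I_m) => /= ->.
Qed.

Lemma spanZ a f : span f -> span (a *: f).
Proof.
move=> [n [c [B [hB ->]]]]; exists n, (fun i => a * c i), B; split => //.
by rewrite scaler_sumr; apply: eq_bigr => i _; rewrite scalerA.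
Qed.

Lemma span_sum n (F : 'I_n -> vert T -> C) :
  (forall i, span (F i)) -> span (\sum_(i < n) F i).
Proof.
move=> hF; elim/big_rec: _ => [|i f _ hf]; first exact: span0.
exact: spanD.
Qed.

Lemma span_indic B : ring_sets B -> span (\1_B).
Proof.
move=> hB; exists 1%N, (fun=> 1), (fun=> B); split => //.
by rewrite big_ord1 scale1r.
Qed.

Lemma span_bounded f : span f -> linfty f.
Proof.
move=> [n [c [B [_ ->]]]]; exists (complex.Re (\sum_(i < n) `|c i|)) => x.
have rS : \sum_(i < n) `|c i| \is Num.real.
  by apply: rpred_sum => i _; exact: normr_real.
rewrite (RRe_real rS).
rewrite fct_sumE (le_trans (ler_norm_sum _ _ _)) //.
rewrite ler_sum // => i _; rewrite normrM -[leRHS]mulr1 ler_wpM2l //.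
by rewrite /indic; case: (_ \in _); rewrite ?normr1 ?normr0.
Qed.

Lemma span_conj f : span f -> span (fun x => (f x)^*).
Proof.
move=> [n [c [B [hB ->]]]]; exists n, (fun i => (c i)^*), B; split => //.
apply/funext => x; rewrite !fct_sumE rmorph_sum; apply: eq_bigr => i _ /=.
rewrite [LHS]rmorphM; congr (_ * _); rewrite /indic.
by case: (_ \in _); rewrite ?rmorph1 ?rmorph0.
Qed.


Local Notation posb := (fun e : edge T => `[< pos e >]).

Lemma is_path_cat u p m q w : is_path u p m -> is_path m q w ->
  (forall p0 e e' q0, p = rcons p0 e -> q = e' :: q0 -> e' <> bar e) ->
  is_path u (p ++ q) w.
Proof.
elim: p u => [u /= <- //|e p IH] u /= [<- hep hp] hq hj; split => //.
  by case: p hep hj {IH hp} => // _; case: q hq => // e' q _ /(_ [::] e e' q); apply.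
by apply: IH => // p0 a e' q0 pE; apply: (hj (e :: p0)); rewrite pE.
Qed.

Lemma is_path_rev u p w : is_path u p w -> is_path w (map (@bar T) (rev p)) u.
Proof.
elim: p u => [u /= -> //|e p IH] u /= [<- hep /IH hp].
rewrite rev_cons map_rcons -cats1; apply: is_path_cat hp _ _.
  by split=> //; [exact: org_bar|rewrite /= -org_bar barK].
move=> p0 a e' q0 + [<- _]; case: p hep {IH} => [|b p] hb.
  by case: p0.
rewrite rev_cons map_rcons => /rcons_inj[_ <-] h.
by apply: hb; rewrite -(barK b) -h.
Qed.

Lemma is_dpath_cons u e q w :
  is_dpath u (e :: q) w <-> [/\ org e = u, pos e & is_dpath (ter e) q w].
Proof.
split=> [[[<- _ hp]] /= /andP[/asboolP he hq]|[<- he [hp hq]]]; first by split.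
split; last by rewrite /= hq andbT; apply/asboolP.
split=> //; case: q hp hq => // e' q _ /= /andP[/asboolP he' _] e'E.
by rewrite e'E in he'; case/pos_bar: he'.
Qed.

Lemma is_dpath_cat u p q w :
  is_dpath u (p ++ q) w <-> exists2 m, is_dpath u p m & is_dpath m q w.
Proof.
elim: p u => [|e p IH] u; first by split => [|[m [/= <-]]//]; exists u.
split.
  by move=> /is_dpath_cons[? ? /IH[m ? ?]]; exists m => //; apply/is_dpath_cons.
by move=> [m /is_dpath_cons[? ? ?] ?]; apply/is_dpath_cons; split => //;
  apply/IH; exists m.
Qed.

Lemma VsetFE v F w : VsetF v F w <-> exists2 p, is_dpath v p w &
  (match p with [::] => True | e :: _ => ~ F e end).
Proof.
split=> [[->|[e [[he <-] hF] [p hp]]]|[[|e p]]].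
- by exists [::].
- by exists (e :: p) => //; apply/is_dpath_cons.
- by move=> [/= -> _] _; left.
- by move=> /is_dpath_cons[he1 he2 hp] hF; right; exists e; [split|exists p].
Qed.

Lemma common_suffix (l1 l2 : seq (edge T)) : exists d1 d2 s,
  [/\ l1 = d1 ++ s, l2 = d2 ++ s
    & forall a b e, d1 = rcons a e -> d2 = rcons b e -> False].
Proof.
elim/last_ind: l1 l2 => [|l1 e IH] l2.
  by exists [::], l2, [::]; split; rewrite ?cats0// => -[].
case/lastP: l2 => [|l2 e'].
  by exists (rcons l1 e), [::], [::]; split; rewrite ?cats0// => ? -[].
have [->|ne] := pselect (e' = e).
  have [d1 [d2 [s [-> -> h]]]] := IH l2.
  by exists d1, d2, (rcons s e); rewrite !rcons_cat.
exists (rcons l1 e), (rcons l2 e'), [::]; rewrite !cats0; split => // a b c.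
by move=> /rcons_inj[_ <-] /rcons_inj[_ /ne].
Qed.

Lemma zigzag_inj (d d' q q' : seq (edge T)) :
  all posb d -> all posb d' -> all posb q -> all posb q' ->
  d ++ map (@bar T) (rev d') = q ++ map (@bar T) (rev q') -> d = q /\ d' = q'.
Proof.
move=> hd hd' hq hq' E.
have neg l : all posb l -> [seq e <- map (@bar T) (rev l) | posb e] = [::].
  elim: l => //= e l IH /andP[/asboolP he /IH].
  rewrite rev_cons map_rcons filter_rcons => ->.
  by case: asboolP => // /pos_bar.
have dq : d = q.
  have := congr1 (seq.filter posb) E.
  by rewrite !filter_cat !neg // !cats0 !(all_filterP _).
split=> //; move: E; rewrite dq => /(congr1 (drop (size q))).
rewrite !drop_size_cat // => /inj_map E.
by rewrite -[d']revK -[q']revK E // => x y xy; rewrite -(barK x) xy barK.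
Qed.
End Graph.

Section Tree.
Variable T : ditree.
Implicit Types (f g : vert T -> C) (v w : vert T).
Local Notation span := (simple_span R T).

Lemma dpath_zigzag v c x v' c' : is_dpath v c x -> is_dpath v' c' x ->
  exists m d d' s, [/\ c = d ++ s, c' = d' ++ s, is_dpath v d m, is_dpath v' d' m
    & is_dpath m s x /\ is_path v (d ++ map (@bar T) (rev d')) v'].
Proof.
have [d [d' [s [-> -> hd]]]] := common_suffix c c'.
move=> /is_dpath_cat[m vdm msx] /is_dpath_cat[m' vdm' msx'].
have mm' : m = m'.
  case: s msx msx' {hd} => [[/= -> _] [/= -> _]//|e s].
  by move=> /is_dpath_cons[<- _ _] /is_dpath_cons[<- _ _].
rewrite -mm' in vdm'; exists m, d, d', s; split=> //; split=> //.
apply: is_path_cat vdm.1 (is_path_rev vdm'.1) _.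
move=> p0 e e' q0 dE; case/lastP: d' hd {vdm'} => [//|d' b] hd.
rewrite rev_rcons /= => -[<- _]; have := hd _ _ _ dE.
by move=> + be; apply; rewrite -(barK b) be barK.
Qed.

Lemma dpath_meet v v' x c c' : is_dpath v c x -> is_dpath v' c' x ->
  exists m q q', [/\ is_dpath v q m, is_dpath v' q' m
    & forall y d d', is_dpath v d y -> is_dpath v' d' y ->
      exists s, [/\ d = q ++ s, d' = q' ++ s & is_dpath m s y]].
Proof.
move=> vcx vcx'; have [m [q [q' [_ [_ _ vq vq' [_ z]]]]]] := dpath_zigzag vcx vcx'.
exists m, q, q'; split => // y d d' vdy vdy'.
have [m1 [r [r' [s [-> -> vr vr' [m1s z1]]]]]] := dpath_zigzag vdy vdy'.
have [p [_ up]] := ditreeP v v'.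
have /zigzag_inj E : r ++ map (@bar T) (rev r') = q ++ map (@bar T) (rev q').
  by rewrite -(up _ z) -(up _ z1).
have [rq rq'] := E vr.2 vr'.2 vq.2 vq'.2.
exists s; rewrite rq rq'; split => //.
suff -> : m = m1 by [].
rewrite rq in vr; case: vq vr => + _ [+ _].
by elim: q v {vcx vdy z z1 up rq E} => [|e q IH] v /= => [<- <-//|[_ _ h] [_ _ /IH]]; apply.
Qed.

Lemma VsetFI v F v' F' :
  finite_set F -> F `<=` Delta1 v -> finite_set F' -> F' `<=` Delta1 v' ->
  VsetF v F `&` VsetF v' F' = set0 \/
  exists m F2, [/\ finite_set F2, F2 `<=` Delta1 m
    & VsetF v F `&` VsetF v' F' = VsetF m F2].
Proof.
move=> fF sF fF' sF'.
have [|/set0P[x [/VsetFE[c vcx hc] /VsetFE[c' vcx' hc']]]] :=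
  eqVneq (VsetF v F `&` VsetF v' F') set0; first by left.
right; have [m [q [q' [vq vq' hm]]]] := dpath_meet vcx vcx'.
exists m, [set e | (q = [::] /\ F e) \/ (q' = [::] /\ F' e)]; split.
- apply: (@sub_finite_set _ _ (F `|` F')); last by rewrite finite_setU.
  by move=> e [[_ ?]|[_ ?]]; [left|right].
- move=> e [[qE /sF[he oe]]|[qE /sF'[he oe]]]; split => //.
    by rewrite oe; move: vq; rewrite qE => -[].
  by rewrite oe; move: vq'; rewrite qE => -[].
have [t [cE cE' _]] := hm _ _ _ vcx vcx'.
apply/seteqP; split=> y.
  move=> [/VsetFE[d vd hd] /VsetFE[d' vd' hd']].
  have [s [dE dE' ms]] := hm _ _ _ vd vd'.
  apply/VsetFE; exists s => //; move: hd hd'; rewrite dE dE'.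
  case: s {dE dE' ms} => // e s hd hd' [[qE Fe]|[qE Fe]].
    by move: hd; rewrite qE; apply.
  by move: hd'; rewrite qE; apply.
move=> /VsetFE[s ms hs]; split; apply/VsetFE.
  exists (q ++ s); first by apply/is_dpath_cat; exists m.
  move: hc; rewrite cE; case: q {vq cE hm} hs => //=.
  by case: s {ms} => // e s h _ Fe; apply: h; left.
exists (q' ++ s); first by apply/is_dpath_cat; exists m.
move: hc'; rewrite cE'; case: q' {vq' cE' hm} hs => //=.
by case: s {ms} => // e s h _ Fe; apply: h; right.
Qed.

Lemma ring_sets_VsetF v F : finite_set F -> F `<=` Delta1 v ->
  ring_sets (VsetF v F).
Proof.
move=> fF sF; exists 1%N, (fun=> v), (fun=> F); split => //.
  by move=> i j _ _ _; rewrite (ord1 i) (ord1 j).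
by apply/seteqP; split=> [x hx|x [] //]; exists ord0.
Qed.

Lemma span_indicM (A B : set (vert T)) : ring_sets A -> ring_sets B ->
  span (\1_A * \1_B).
Proof.
have dec n (v : 'I_n -> vert T) (F : 'I_n -> set (edge T)) :
    trivIset setT (fun i => VsetF (v i) (F i)) ->
    \1_(\bigcup_i VsetF (v i) (F i)) =
    \sum_(i < n) \1_(VsetF (v i) (F i)) :> (vert T -> C).
  move=> tI; apply/funext => x; rewrite fct_sumE [LHS]/indic.
  case: (boolP (x \in _)) => [/set_mem[i _ xi]|/negP nx].
    rewrite (bigD1 i) //= big1 ?addr0 => [|j ji]; first by rewrite /indic mem_set.
    rewrite /indic memNset// => xj; move: ji; apply/negP/negPn/eqP.
    by apply: tI => //; exists x.
  rewrite big1 // => i _; rewrite /indic memNset// => xi; apply: nx.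
  by rewrite mem_set //; exists i.
move=> [n [v [F [hF tF ->]]]] [m [w [G [hG tG ->]]]].
rewrite !dec // mulr_suml; apply: span_sum => i.
rewrite mulr_sumr; apply: span_sum => j.
have -> : \1_(VsetF (v i) (F i)) * \1_(VsetF (w j) (G j)) =
    \1_(VsetF (v i) (F i) `&` VsetF (w j) (G j)) :> (vert T -> C).
  by rewrite indicI.
have [fF sF] := hF i; have [fG sG] := hG j.
have [->|[u [H [fH sH ->]]]] := VsetFI fF sF fG sG.
  suff -> : \1_set0 = 0 :> (vert T -> C) by exact: span0.
  by apply/funext => x; rewrite /indic in_set0.
exact/span_indic/ring_sets_VsetF.
Qed.

Lemma spanM f g : span f -> span g -> span (f * g).
Proof.
move=> [n [c [B [hB ->]]]] [m [d [D [hD ->]]]].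
rewrite mulr_suml; apply: span_sum => i.
rewrite mulr_sumr; apply: span_sum => j.
suff -> : (c i *: \1_(B i)) * (d j *: \1_(D j)) =
   (c i * d j) *: (\1_(B i) * \1_(D j)) :> (vert T -> C).
  exact/spanZ/span_indicM.
by apply/funext => x; rewrite /GRing.scale/= mulrACA.
Qed.

End Tree.

Lemma real_bound (a : C) : exists2 K : R, 0 < K & `|a| <= K%:C.
Proof.
have na : (complex.Re `|a|)%:C = `|a| by rewrite RRe_real ?normr_real.
exists (complex.Re `|a| + 1).
  by rewrite ltr_wpDl // -lecR rmorph0 na.
by rewrite rmorphD /= na lerDl ler01.
Qed.

Lemma linfty_bound (X : Type) (f : X -> C) : linfty f ->
  exists2 K : R, 0 < K & forall x, `|f x| <= K%:C.
Proof.
move=> [M hM]; exists (Num.max M 1); first by rewrite lt_max ltr01 orbT.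
by move=> x; rewrite (le_trans (hM x)) // lecR le_max lexx.
Qed.

Lemma AT_predP (T : digraph) (f : vert T -> C) : f \in AT_pred R T <->
  linfty f /\ sup_closure (simple_span R T) f.
Proof. by split=> [/asboolP|?] //; apply/asboolP. Qed.

Lemma AT_submod_closed (T : digraph) : submod_closed (AT_pred R T).
Proof.
split.
  apply/AT_predP; split; first by exists 0 => x; rewrite normr0.
  by move=> e e0; exists 0; [exact: span0|move=> x; rewrite subr0 normr0 lecR ltW].
move=> a f g /AT_predP[bf cf] /AT_predP[bg cg]; apply/AT_predP.
have [K K0 aK] := real_bound a; split.
  have [M M0 fM] := linfty_bound bf; have [N N0 gN] := linfty_bound bg.
  exists (K * M + N) => x; rewrite (le_trans (ler_normD _ _)) // rmorphD.
  by rewrite lerD //= normrM rmorphM ler_pM.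
move=> e e0; have e2 : 0 < e / 2 by rewrite divr_gt0.
have [f' sf' ff'] := cf (e / 2 / K) (divr_gt0 e2 K0).
have [g' sg' gg'] := cg (e / 2) e2.
exists (a *: f' + g'); first by apply: spanD => //; exact: spanZ.
move=> x; rewrite opprD addrACA -scalerBr (le_trans (ler_normD _ _)) //.
rewrite [e]splitr rmorphD lerD //= normrM.
rewrite -[e / 2](divfK (lt0r_neq0 K0)) mulrC rmorphM ler_pM //.
Qed.

Lemma AT_mul_closed (T : ditree) (f g : vert T -> C) :
  f \in AT_pred R T -> g \in AT_pred R T -> f * g \in AT_pred R T.
Proof.
move=> /AT_predP[bf cf] /AT_predP[bg cg]; apply/AT_predP.
have [M M0 fM] := linfty_bound bf; have [N N0 gN] := linfty_bound bg; split.
  by exists (M * N) => x; rewrite /= normrM rmorphM ler_pM.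
move=> e e0; have e2 : 0 < e / 2 by rewrite divr_gt0.
have [g' sg' gg'] := cg (e / 2 / M) (divr_gt0 e2 M0).
have [K K0 gK] := linfty_bound (span_bounded sg').
have [f' sf' ff'] := cf (e / 2 / K) (divr_gt0 e2 K0).
exists (f' * g'); first exact: spanM.
move=> x; have -> : (f * g) x - (f' * g') x = f x * (g x - g' x) + (f x - f' x) * g' x.
  by rewrite mulrBr mulrBl addrA subrK.
rewrite [e]splitr rmorphD (le_trans (ler_normD _ _)) // lerD //= normrM.
  by rewrite -[e / 2](divfK (lt0r_neq0 M0)) mulrC rmorphM ler_pM.
by rewrite -[e / 2](divfK (lt0r_neq0 K0)) rmorphM ler_pM.
Qed.

Lemma AT_conj_closed (T : digraph) (f : vert T -> C) :
  f \in AT_pred R T -> (fun x => (f x)^*) \in AT_pred R T.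
Proof.
move=> /AT_predP[[M hM] cf]; apply/AT_predP; split.
  by exists M => x; rewrite norm_conjC.
move=> e /cf[g sg fg]; exists (fun x => (g x)^*); first exact: span_conj.
by move=> x; rewrite -rmorphB norm_conjC.
Qed.

End SimpleSpan.

HB.instance Definition _ (R : realType) (T : digraph) :=
  GRing.isSubmodClosed.Build R[i] (vert T -> R[i]) (AT_pred R T)
    (@AT_submod_closed R T).

Record AT (R : realType) (T : digraph) := MkAT {
  AT_fun :> vert T -> R[i];
  AT_funP : AT_fun \in AT_pred R T }.

HB.instance Definition _ R T := [isSub for @AT_fun R T].
HB.instance Definition _ R T := [Choice of AT R T by <:].
HB.instance Definition _ R T := [SubChoice_isSubLmodule of AT R T by <:].

Section AlgebraStructure.
Variables (R : realType) (T : ditree).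
Local Notation A := (AT R T).
Implicit Types f g h : A.

Definition AT_mul f g : A := MkAT (AT_mul_closed (AT_funP f) (AT_funP g)).
Definition AT_star f : A := MkAT (AT_conj_closed (AT_funP f)).

Lemma AT_mulA : associative AT_mul.
Proof. by move=> f g h; apply: val_inj; exact: mulrA. Qed.

Lemma AT_mulDl : left_distributive AT_mul +%R.
Proof. by move=> f g h; apply: val_inj; exact: mulrDl. Qed.

Lemma AT_mulDr : right_distributive AT_mul +%R.
Proof. by move=> f g h; apply: val_inj; exact: mulrDr. Qed.

Lemma AT_mulZl (a : R[i]) f g : AT_mul (a *: f) g = a *: AT_mul f g.
Proof. by apply: val_inj; apply/funext => x; exact/esym/mulrA. Qed.

Lemma AT_mulZr (a : R[i]) f g : AT_mul f (a *: g) = a *: AT_mul f g.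
Proof. by apply: val_inj; apply/funext => x; exact: mulrCA. Qed.

Lemma AT_starK : involutive AT_star.
Proof.
by move=> f; apply: val_inj; apply/funext => x; exact: conjCK.
Qed.

Lemma AT_starD f g : AT_star (f + g) = AT_star f + AT_star g.
Proof. by apply: val_inj; apply/funext => x; exact: rmorphD. Qed.

Lemma AT_starZ (a : R[i]) f : AT_star (a *: f) = a^* *: AT_star f.
Proof. by apply: val_inj; apply/funext => x; exact: rmorphM. Qed.

Lemma AT_starM f g : AT_star (AT_mul f g) = AT_mul (AT_star g) (AT_star f).
Proof. by apply: val_inj; apply/funext => x /=; rewrite rmorphM mulrC. Qed.

HB.instance Definition _ := Lmodule_isStarAlgebra.Build R[i] (AT R T)
  AT_mulA AT_mulDl AT_mulDr AT_mulZl AT_mulZr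
  AT_starK AT_starD AT_starZ AT_starM.

(* An ideal of a C*-algebra is, as usual, a norm-closed one; the norm of A(T)
   is the supremum norm. *)
Record closed_ideal (J : set A) : Prop := ClosedIdeal {
  closed_ideal0 : J 0;
  closed_idealD : forall f g, J f -> J g -> J (f + g);
  closed_idealZ : forall (a : R[i]) f, J f -> J (a *: f);
  closed_idealMl : forall f g, J g -> J (smul f g);
  closed_idealMr : forall f g, J f -> J (smul f g);
  closed_ideal_closed : forall f,
    sup_closure [set (AT_fun g) | g in J] f -> J f }.

(* The closed ideal of A(T) generated by the characteristic functions of the
   singletons {v}, v in S. *)
Definition C0 (S : set (vert T)) : set A :=
  \bigcap_(J in [set J | closed_ideal J /\
     forall v f, S v -> f = \1_[set v] :> (vert T -> R[i]) -> J f]) J.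

Lemma closed_ideal_C0 S : closed_ideal (C0 S).
Proof.
split.
- by move=> J [/closed_ideal0].
- by move=> f g hf hg J hJ; apply: closed_idealD; [case: hJ|exact: hf|exact: hg].
- by move=> a f hf J hJ; apply: closed_idealZ; [case: hJ|exact: hf].
- by move=> f g hg J hJ; apply: closed_idealMl; [case: hJ|exact: hg].
- by move=> f g hf J hJ; apply: closed_idealMr; [case: hJ|exact: hf].
- move=> f hf J hJ; apply: closed_ideal_closed; first by case: hJ.
  by move=> e /hf[_ [g hg <-] fg]; exists g => //; exists g => //; exact: hg.
Qed.

Lemma C0_star S f : C0 S f -> C0 S (star f).
Proof.
move=> hf J [iJ gJ].
apply: (hf [set g | J (star g)]); split; last first.
  move=> v g Sv gE; apply: (gJ v) => //; apply/funext => x /=.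
  rewrite gE /indic; case: (_ \in _); [exact: rmorph1|exact: rmorph0].
split => /=.
- suff -> : star 0 = 0 :> A by exact: closed_ideal0.
  by apply: val_inj; apply/funext => x; exact: rmorph0.
- by move=> g h Jg Jh; rewrite starD; exact: closed_idealD.
- by move=> a g Jg; rewrite starZ; exact: closed_idealZ.
- by move=> g h Jh; rewrite starM; exact: closed_idealMr.
- by move=> g h Jg; rewrite starM; exact: closed_idealMl.
- move=> g hg; apply: closed_ideal_closed => // e /hg[_ [h Jh <-] gh].
  exists (AT_fun (star h)); first by exists (star h).
  by move=> x; rewrite /= -rmorphB norm_conjC.
Qed.

Definition C0_pred (S : set (vert T)) : {pred A} := [pred f | `[< C0 S f >]].

Lemma C0_predP S f : f \in C0_pred S <-> C0 S f.
Proof. by split=> [/asboolP|?] //; apply/asboolP. Qed.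

Lemma C0_submod_closed S : submod_closed (C0_pred S).
Proof.
have iC := closed_ideal_C0 S.
split; first by apply/C0_predP; exact: closed_ideal0.
move=> a f g /C0_predP hf /C0_predP hg; apply/C0_predP.
by apply: (closed_idealD iC) => //; exact: (closed_idealZ iC).
Qed.

HB.instance Definition _ S :=
  GRing.isSubmodClosed.Build R[i] A (C0_pred S) (C0_submod_closed S).

End AlgebraStructure.
Arguments C0 R {T} S.
Arguments C0_pred R {T} S.

Definition ATS (R : realType) (T : ditree) (S : set (vert T)) : Type :=
  Quotient.quot (C0_pred R S).
Arguments ATS R {T} S.

Section QuotientAlgebra.
Variables (R : realType) (T : ditree) (S : set (vert T)).
Local Notation A := (AT R T).
Local Notation Q := (ATS R S).
Local Notation J := (C0_pred R S).

HB.instance Definition _ := EqQuotient.on Q.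
HB.instance Definition _ := GRing.Zmodule.on Q.

Definition ATS_proj : A -> Q := \pi_Q.

Let iC : closed_ideal (C0 R S) := @closed_ideal_C0 R T S.

Lemma ATS_projP f g : ATS_proj f = ATS_proj g <-> C0 R S (f - g).
Proof.
split=> [/eqP|h].
  by rewrite /ATS_proj /= -Quotient.idealrBE => /C0_predP.
by apply/eqP; rewrite /ATS_proj /= -Quotient.idealrBE; apply/C0_predP.
Qed.

Lemma ATS_projK (x : Q) : ATS_proj (repr x) = x.
Proof. exact: reprK. Qed.

Lemma ATS_projD f g : ATS_proj (f + g) = ATS_proj f + ATS_proj g.
Proof. by rewrite /ATS_proj; exact: Quotient.pi_add. Qed.

Definition ATS_scale (a : R[i]) (x : Q) : Q := ATS_proj (a *: repr x).
Definition ATS_mul (x y : Q) : Q := ATS_proj (smul (repr x) (repr y)).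
Definition ATS_star (x : Q) : Q := ATS_proj (star (repr x)).

Lemma ATS_scaleE a f : ATS_scale a (ATS_proj f) = ATS_proj (a *: f).
Proof.
apply/ATS_projP; rewrite -scalerBr; apply: (closed_idealZ iC).
by apply/ATS_projP; rewrite ATS_projK.
Qed.

Lemma ATS_mulE f g : ATS_mul (ATS_proj f) (ATS_proj g) = ATS_proj (smul f g).
Proof.
set f' := repr (ATS_proj f); set g' := repr (ATS_proj g).
have ff : C0 R S (f' - f) by apply/ATS_projP; rewrite ATS_projK.
have gg : C0 R S (g' - g) by apply/ATS_projP; rewrite ATS_projK.
apply/ATS_projP; rewrite -/f' -/g'.
suff -> : smul f' g' - smul f g = smul f' (g' - g) + smul (f' - f) g.
  by apply: (closed_idealD iC);
    [exact: (closed_idealMl iC)|exact: (closed_idealMr iC)].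
by rewrite smulDr smulDl smulrN smulNr addrA subrK.
Qed.

Lemma ATS_starE f : ATS_star (ATS_proj f) = ATS_proj (star f).
Proof.
apply/ATS_projP; set f' := repr _.
have -> : star f' - star f = star (f' - f).
  by rewrite starD starN.
by apply: C0_star; apply/ATS_projP; rewrite ATS_projK.
Qed.

Let ind (P : Q -> Prop) : (forall f, P (ATS_proj f)) -> forall x, P x.
Proof. by move=> h x; rewrite -(ATS_projK x). Qed.

Let scaleA a b x : ATS_scale a (ATS_scale b x) = ATS_scale (a * b) x.
Proof. by elim/ind: x => f; rewrite !ATS_scaleE scalerA. Qed.

Let scale1 : left_id 1 ATS_scale.
Proof. by elim/ind => f; rewrite ATS_scaleE scale1r. Qed.

Let scaleDr : right_distributive ATS_scale +%R.
Proof.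
move=> a; elim/ind=> f; elim/ind=> g.
by rewrite -ATS_projD !ATS_scaleE -ATS_projD scalerDr.
Qed.

Let scaleDl x : {morph ATS_scale^~ x : a b / a + b}.
Proof. by elim/ind: x => f a b; rewrite !ATS_scaleE -ATS_projD scalerDl. Qed.

HB.instance Definition _ := GRing.Zmodule_isLmodule.Build R[i] Q
  scaleA scale1 scaleDr scaleDl.

Lemma ATS_proj_linear : linear ATS_proj.
Proof. by move=> a f g; rewrite ATS_projD -ATS_scaleE. Qed.

HB.instance Definition _ :=
  GRing.isLinear.Build R[i] A Q *:%R ATS_proj ATS_proj_linear.

Let mulA : associative ATS_mul.
Proof.
by elim/ind=> f; elim/ind=> g; elim/ind=> h; rewrite !ATS_mulE smulA.
Qed.

Let mulDl : left_distributive ATS_mul +%R.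
Proof.
elim/ind=> f; elim/ind=> g; elim/ind=> h.
by rewrite -ATS_projD !ATS_mulE -ATS_projD smulDl.
Qed.

Let mulDr : right_distributive ATS_mul +%R.
Proof.
elim/ind=> f; elim/ind=> g; elim/ind=> h.
by rewrite -ATS_projD !ATS_mulE -ATS_projD smulDr.
Qed.

Let mulZl (a : R[i]) (x y : Q) : ATS_mul (a *: x) y = a *: ATS_mul x y.
Proof.
elim/ind: x => f; elim/ind: y => g.
by rewrite -linearZ !ATS_mulE -linearZ smulZl.
Qed.

Let mulZr (a : R[i]) (x y : Q) : ATS_mul x (a *: y) = a *: ATS_mul x y.
Proof.
elim/ind: x => f; elim/ind: y => g.
by rewrite -linearZ !ATS_mulE -linearZ smulZr.
Qed.

Let star_K : involutive ATS_star.
Proof. by elim/ind=> f; rewrite !ATS_starE starK. Qed.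

Let star_D (x y : Q) : ATS_star (x + y) = ATS_star x + ATS_star y.
Proof.
elim/ind: x => f; elim/ind: y => g.
by rewrite -ATS_projD !ATS_starE -ATS_projD starD.
Qed.

Let star_Z (a : R[i]) (x : Q) : ATS_star (a *: x) = a^* *: ATS_star x.
Proof.
by elim/ind: x => f; rewrite -linearZ !ATS_starE -linearZ starZ.
Qed.

Let star_M (x y : Q) : ATS_star (ATS_mul x y) = ATS_mul (ATS_star y) (ATS_star x).
Proof.
by elim/ind: x => f; elim/ind: y => g; rewrite !(ATS_mulE, ATS_starE) starM.
Qed.

HB.instance Definition _ := Lmodule_isStarAlgebra.Build R[i] Q
  mulA mulDl mulDr mulZl mulZr star_K star_D star_Z star_M.

Lemma ATS_proj_star_hom : star_hom ATS_proj.
Proof. by split=> [f g|f]; [exact/esym/ATS_mulE|exact/esym/ATS_starE]. Qed.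

End QuotientAlgebra.
Arguments ATS_proj R {T} S.

(* A *-homomorphism A(T1) -> A(T2) is determined by its values on the
   characteristic functions of the sets V_T1(v;F). *)
Definition induced_by (R : realType) (T1 T2 : ditree)
    (alpha : dimorphism T1 T2) (phi : {linear AT R T1 -> AT R T2}) : Prop :=
  star_hom phi /\
  forall (v : vert T1) (F : set (edge T1)),
    finite_set F -> F `<=` Delta1 v ->
    forall f : AT R T1, f = \1_(VsetF v F) :> (vert T1 -> R[i]) ->
      phi f = \1_(VsetF (mor_vert alpha v) (mor_edge alpha @` F))
        :> (vert T2 -> R[i]).

(* Main.v *)
(* Suppose that x in T2 lies on a directed path leaving alpha(T1) at alpha m.
   Then, T2 being a tree, x is in V(alpha v; alpha F) iff m is in V(v; F), so
   that evaluating alpha_* f at x and evaluating f at m agree on generators,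
   hence on A(T1), once evaluation of alpha_* f at x is known to be continuous.
   On the other hand C_0(S) consists of the functions that are small off finite
   subsets of S.  If alpha_* f is in C_0(S2) and f v <> 0, then alpha v is in
   S2; were some positive edge at alpha v missing from alpha(T1), alpha_* f
   would have the constant value f v on everything beyond this edge, which would
   put an infinite ray in a finite subset of S2.  So v is in S1. *)
Require Import Defs.
From HB Require Import structures.
From mathcomp Require Import all_boot all_order all_algebra.
From mathcomp Require Import complex.
From mathcomp Require Import all_classical all_reals numfun.
Import Order.TTheory GRing.Theory Num.Theory.
Local Open Scope classical_set_scope.
Local Open Scope ring_scope.
Local Open Scope complex_scope.

Set Implicit Arguments.
Unset Strict Implicit.

(** * Unique paths in a tree and sets with one vertex *)

Section Paths.
Variable T : ditree.
Implicit Types u v w : vert T.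

Lemma is_path_unique u v p q : is_path u p v -> is_path u q v -> p = q.
Proof.
by move=> hp hq; have [r [_ h]] := ditreeP u v; rewrite -(h p) // -(h q).
Qed.

Lemma VsetF_Delta1 v : VsetF v (Delta1 v) = [set v].
Proof. by rewrite /VsetF setDv bigcup_set0 setU0. Qed.

End Paths.

(** * Paths and positive edges under a monomorphism of trees *)

Section Morphism.
Variables (T1 T2 : ditree) (alpha : dimorphism T1 T2).
Hypothesis alpha_mono : monomorphism alpha.
Local Notation av := (mor_vert alpha).
Local Notation ae := (mor_edge alpha).

(** If [e] is not positive, then [bar e] is, hence so is [bar (ae e)], which excludes [ae e]. *)
Lemma mor_posE e : pos (ae e) <-> pos e.
Proof.
split=> [h|]; last exact: mor_pos.
apply: contrapT => /pos_bar /(@mor_pos _ _ alpha).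
by rewrite -mor_bar => /pos_bar.
Qed.

Lemma is_path_mor u p v : is_path u p v -> is_path (av u) (map ae p) (av v).
Proof.
elim: p u => [u /= -> //|e p IH] u [<- hep hp]; split; first exact: mor_org.
  by case: p hep {IH hp} => //= e' _ h E; apply: h; apply: alpha_mono.2; rewrite -mor_bar.
by rewrite mor_ter; exact: IH.
Qed.

(** The path from [u] to [v] in [T1] has an image, and [T2] has only one path between its ends. *)
Lemma is_path_mor_inv u q v :
  is_path (av u) q (av v) -> exists2 p, q = map ae p & is_path u p v.
Proof.
move=> hq; have [p [hp _]] := ditreeP u v; exists p => //.
exact: is_path_unique hq (is_path_mor hp).
Qed.

Lemma all_pos_mor p :
  all (fun e => `[< pos e >]) (map ae p) =
  all (fun e => `[< pos e >]) p.
Proof.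
by rewrite all_map; apply: eq_all => e /=; apply/asboolP/asboolP => /mor_posE.
Qed.

Lemma is_dpath_mor u p v : is_dpath u p v -> is_dpath (av u) (map ae p) (av v).
Proof. by move=> [hp pp]; split; [exact: is_path_mor|rewrite all_pos_mor]. Qed.

Lemma is_dpath_mor_inv u q v :
  is_dpath (av u) q (av v) -> exists2 p, q = map ae p & is_dpath u p v.
Proof.
move=> [/is_path_mor_inv[p -> hp] hq]; exists p => //; split => //.
by rewrite -all_pos_mor.
Qed.

(* The hypothesis says that alpha m is the last vertex of alpha(T1) on a
   directed path to x. *)
Lemma VsetF_mor m x v F : VsetF (av m) (range ae) x ->
  VsetF (av v) (ae @` F) x <-> VsetF v F m.
Proof.
move=> /VsetFE[p mpx hp]; split.
  move=> /VsetFE[c vcx hc].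
  (* The paths [p] and [c] merge at [n], and the reduced path from [av m] to [av v] through [n]
     comes from [T1]. If [a] were nonempty, [p] would start with an edge of [range ae]; so [c]
     passes through [av m]. *)
  have [n [a [a' [s [pE cE ma va' [_ z]]]]]] := dpath_zigzag mpx vcx.
  have [b bE _] := is_path_mor_inv z.
  case: a ma bE pE {z} => [[mn _] _ _|e a _ bE pE]; last first.
    by case: b bE hp => // e' b [eE _]; rewrite pE => -[]; exists e'.
  rewrite -mn in va'; have [d dE vd] := is_dpath_mor_inv va'.
  apply/VsetFE; exists d => //.
  by case: d dE {vd} => // e d dE Fe; move: hc; rewrite cE dE; case; exists e.
move=> /VsetFE[d vd hd]; apply/VsetFE; exists (map ae d ++ p).
  by apply/is_dpath_cat; exists (av m) => //; exact: is_dpath_mor.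
case: d hd {vd} => [_|e d hd] /=.
  by case: p hp {mpx} => // e p h [e' _ eE]; apply: h; exists e'.
by move=> [e' Fe' /(alpha_mono.2 _ _) e'E]; apply: hd; rewrite -e'E.
Qed.

Lemma VsetF_mor_self (F : set (edge T2)) m : VsetF (av m) F (av m).
Proof. by left. Qed.

End Morphism.

(** * Characters, density and closed ideals of A(T) *)

Section FunctionAlgebra.
Variables (R : realType) (T : ditree).
Local Notation C := R[i].
Local Notation A := (AT R T).

Lemma AT_sup_closed (f : vert T -> C) :
  sup_closure (fun g => g \in AT_pred R T) f -> f \in AT_pred R T.
Proof.
move=> hf; apply/AT_predP; split.
  have [g /AT_predP[[M gM] _] fg] := hf 1 ltr01.
  exists (1 + M) => x; rewrite -[f x](subrK (g x)) (le_trans (ler_normD _ _)) //.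
  by rewrite rmorphD lerD.
move=> e e0; have e2 : 0 < e / 2 by rewrite divr_gt0.
have [g /AT_predP[_ /(_ _ e2)[h sh gh]] fg] := hf _ e2; exists h => // x.
rewrite -[f x](subrK (g x)) -addrA (le_trans (ler_normD _ _)) //.
by rewrite [e]splitr rmorphD lerD.
Qed.

(** The order on [R[i]] is only partial, but both sides here are real. *)
Lemma ltcR_normNge (K : R) (z : C) : (K%:C < `|z|) = ~~ (`|z| <= K%:C).
Proof. by rewrite -real_ltNge ?normr_real // (complex_real K 0). Qed.

(* For |f| <= 1/2, the function f / (1 - f) is the uniform limit of the
   iterates of g |-> f + f g starting from 0. *)
Lemma AT_geometric (f : A) : (forall x, `|f x| <= (2^-1 : R)%:C) ->
  exists g : A, g = f + smul f g.
Proof.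
move=> hf; pose g x := f x / (1 - f x).
have half : 1 - (2^-1)%:C = (2^-1 : R)%:C.
  rewrite -[1]/(1%:C) -rmorphB; congr (_%:C).
  by rewrite [X in X - _]splitr mul1r addrK.
have h1 x : (2^-1 : R)%:C <= `|1 - f x|.
  by rewrite -half -[X in X - _](@normr1 C) (le_trans _ (lerB_dist _ _)) // lerB.
have nz x : 1 - f x != 0 by rewrite -normr_gt0 (lt_le_trans _ (h1 x)) // ltcR invr_gt0.
have gE x : g x = f x + f x * g x.
  by apply: (mulIf (nz x)); rewrite /g divfK // mulrDl -mulrA divfK // mulrBr mulr1 subrK.
have approx n : exists2 a : A, True & forall x, `|g x - a x| <= ((2^-1) ^+ n : R)%:C.
  elim: n => [|n [a _ ga]].
    exists 0 => // x; rewrite [(0 : A) x]/(0 : C) subr0 /g normf_div expr0 ler_pdivrMr ?normr_gt0 //.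
    by rewrite mul1r (le_trans (hf x)).
  exists (f + smul f a) => // x.
  rewrite gE [(f + _) x]/(f x + f x * a x) opprD addrACA subrr add0r -mulrBr.
  by rewrite normrM exprS rmorphM ler_pM.
have gA : g \in AT_pred R T.
  apply: AT_sup_closed => e e0.
  have [a _ ga] := approx (Num.bound e^-1); exists a; first exact: AT_funP.
  move=> x; rewrite (le_trans (ga x)) // lecR exprVn invf_ple ?posrE ?exprn_gt0 //.
  by apply: ltW; apply: upper_nthrootP.
by exists (MkAT gA); apply: val_inj; apply/funext => x; exact: gE.
Qed.

(* A C*-algebra character has norm at most 1; the weaker constant 2 suffices for
   continuity. *)
Lemma character_bounded (chi : A -> C) (K : R) (f : A) :
  (forall g h, chi (g + h) = chi g + chi h) ->
  (forall a g, chi (a *: g) = a * chi g) ->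
  (forall g h, chi (smul g h) = chi g * chi h) ->
  0 < K -> (forall x, `|f x| <= K%:C) -> `|chi f| <= (2 * K)%:C.
Proof.
move=> chiD chiZ chiM K0 hf; apply/negPn/negP; rewrite -ltcR_normNge => hK.
have c0 : 0 < `|chi f| by rewrite (lt_trans _ hK) // ltcR mulr_gt0.
(* Since [chi f] exceeds [2 * K] in modulus, the rescaled [f] is bounded by 1/2 and [chi] maps it to
   1; applying [chi] to the equation for [g] then gives [chi g = 1 + chi g]. *)
have [|g /(congr1 chi)] := @AT_geometric ((chi f)^-1 *: f).
  move=> x; rewrite [(_ *: f) x]/(_ * f x) normrM normfV mulrC ler_pdivrMr //.
  have KE : K = 2^-1 * (2 * K) by rewrite mulKf ?pnatr_eq0.
  rewrite (le_trans (hf x)) // [in leLHS]KE rmorphM.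
  by rewrite ler_wpM2l ?(ltW hK) // lecR invr_ge0.
rewrite chiD chiM chiZ mulVf -?normr_gt0 // mul1r => /eqP.
by rewrite -subr_eq subrr eq_sym oner_eq0.
Qed.

Lemma AT_indic v F : finite_set F -> F `<=` Delta1 v ->
  (\1_(VsetF v F) : vert T -> C) \in AT_pred R T.
Proof.
move=> fF sF; have sv : simple_span R T (\1_(VsetF v F)).
  exact/span_indic/ring_sets_VsetF.
apply/AT_predP; split; first exact: span_bounded.
by move=> e e0; exists (\1_(VsetF v F)) => // x; rewrite subrr normr0 lecR ltW.
Qed.

(** Ring sets are finite disjoint unions of sets [VsetF v F], so the indicators of the latter span a
    dense subspace. *)
Lemma AT_density (P : set A) : P 0 ->
  (forall f g, P f -> P g -> P (f + g)) ->
  (forall a f, P f -> P (a *: f)) ->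
  (forall f : A, sup_closure [set AT_fun g | g in P] f -> P f) ->
  (forall v F (f : A), finite_set F -> F `<=` Delta1 v ->
     f = \1_(VsetF v F) :> (vert T -> C) -> P f) ->
  forall f, P f.
Proof.
move=> P0 PD PZ Pcl Pind f; apply: Pcl => e e0.
have [_ /(_ e e0)[g sg fg]] := (AT_predP (AT_fun f)).1 (AT_funP f).
exists g => // {f fg e e0}.
(* The span consists of bare functions, so [P] is carried along through a lift to [A]. *)
pose Q (g : vert T -> C) := exists2 f : A, P f & AT_fun f = g.
have Qsum n (G : 'I_n -> vert T -> C) : (forall i, Q (G i)) -> Q (\sum_i G i).
  move=> hG; elim/big_rec: _ => [|i _ _ [h Ph <-]]; first by exists 0.
  by have [k Pk <-] := hG i; exists (k + h) => //; exact: PD.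
case: sg => n [c [B [hB ->]]]; apply: (Qsum) => i.
suff [h Ph <-] : Q (\1_(B i)) by exists (c i *: h) => //; exact: PZ.
have [m [v [F [hF tF ->]]]] := hB i.
suff -> : \1_(\bigcup_j VsetF (v j) (F j)) = \sum_j \1_(VsetF (v j) (F j)) :> (vert T -> C).
  apply: Qsum => j; have [fF sF] := hF j.
  by exists (MkAT (AT_indic fF sF)) => //; exact: (Pind _ _ _ fF sF).
apply/funext => x; rewrite fct_sumE [LHS]/indic.
case: (boolP (x \in _)) => [/set_mem[j _ xj]|/negP nx].
  rewrite (bigD1 j) //= big1 ?addr0 => [|k kj]; first by rewrite /indic mem_set.
  rewrite /indic memNset// => xk; move: kj; apply/negP/negPn/eqP.
  by apply: tF => //; exists x.
rewrite big1 // => j _; rewrite /indic memNset// => xj; apply: nx.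
by rewrite mem_set //; exists j.
Qed.

Lemma sigma_indic v : Sigma v -> (\1_[set v] : vert T -> C) \in AT_pred R T.
Proof. by move=> [_ fv]; rewrite -VsetF_Delta1; exact: AT_indic. Qed.

(** The functions with this smallness property form a closed ideal that contains the generators. *)
Lemma C0_small (S : set (vert T)) (f : A) : C0 R S f -> forall e : R, 0 < e ->
  exists F, [/\ finite_set F, F `<=` S & forall x, ~ F x -> `|f x| <= e%:C].
Proof.
pose J : set A := [set f | forall e : R, 0 < e ->
  exists F, [/\ finite_set F, F `<=` S & forall x, ~ F x -> `|f x| <= e%:C]].
move=> Cf; apply: (Cf J); split; last first.
  move=> v g Sv gE e e0; exists [set v]; split => [//|_ ->//|x xv].
  by rewrite gE /indic memNset // normr0 lecR ltW.
have JM (g h : A) : J h -> J (smul g h).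
  move=> hh e e0; have [[M gM] _] := (AT_predP (AT_fun g)).1 (AT_funP g).
  have [K K0 gK] := linfty_bound (ex_intro _ M gM).
  have [F [fF sF hF]] := hh (e / K) (divr_gt0 e0 K0); exists F; split => // x Fx.
  rewrite [smul g h x]/(g x * h x) normrM (le_trans (ler_pM _ _ (gK x) (hF x Fx))) //.
  by rewrite -rmorphM mulrC divfK ?gt_eqF.
split => //.
- by move=> e e0; exists set0; split => // x _; rewrite [(0 : A) x]/(0 : C) normr0 lecR ltW.
- move=> g h hg hh e e0; have e2 : 0 < e / 2 by rewrite divr_gt0.
  have [F [fF sF gF]] := hg _ e2; have [G [fG sG hG]] := hh _ e2.
  exists (F `|` G); split; first by rewrite finite_setU.
    by move=> x [/sF|/sG].
  move=> x /not_orP[Fx Gx]; rewrite [(g + h) x]/(g x + h x) (le_trans (ler_normD _ _)) //.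
  by rewrite [e]splitr rmorphD lerD //; [exact: gF|exact: hG].
- move=> a g hg e e0; have [K K0 aK] := real_bound a.
  have [F [fF sF gF]] := hg (e / K) (divr_gt0 e0 K0); exists F; split => // x Fx.
  rewrite [(a *: g) x]/(a * g x) normrM (le_trans (ler_pM _ _ aK (gF x Fx))) //.
  by rewrite -rmorphM mulrC divfK ?gt_eqF.
- move=> g h hg; suff -> : smul g h = smul h g by exact: JM.
  by apply: val_inj; exact: mulrC.
- move=> g hg e e0; have e2 : 0 < e / 2 by rewrite divr_gt0.
  have [_ [h hh <-] gh] := hg _ e2; have [F [fF sF hF]] := hh _ e2.
  exists F; split => // x Fx; rewrite -[g x](subrK (h x)) (le_trans (ler_normD _ _)) //.
  by rewrite [e]splitr rmorphD lerD // hF.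
Qed.

(** Truncating [f] to [F] moves it by at most [e], and the truncation is a finite combination of
    generators. *)
Lemma small_C0 (S : set (vert T)) (f : A) : S `<=` @Sigma T ->
  (forall e : R, 0 < e ->
    exists F, [/\ finite_set F, F `<=` S & forall x, ~ F x -> `|f x| <= e%:C]) ->
  C0 R S f.
Proof.
move=> SS hf; have iC := @closed_ideal_C0 R T S.
apply: (closed_ideal_closed iC) => e e0; have [F [fF sF hF]] := hf e e0.
have [g Cg [gF gNF]] : exists2 g : A, C0 R S g &
    (forall x, F x -> g x = f x) /\ (forall x, ~ F x -> g x = 0).
  have [n /card_set_bijP[r [rn rI _]]] := fF.
  (* Induction along the numbering [r] of [F]: each step corrects [g] at the point numbered [n], if
     there is one. *)
  have [g Cg [gN gF]] : exists2 g : A, C0 R S g & (forall x, ~ F x -> g x = 0) /\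
      (forall x, F x -> (r x < n)%N -> g x = f x).
    elim: n {rn} => [|n [g Cg [gN gF]]]; first by exists 0; first exact: closed_ideal0.
    have [[u [Fu ru]]|nou] := pselect (exists u, F u /\ r u = n); last first.
      exists g => //; split => // x Fx; rewrite ltnS leq_eqVlt => /predU1P[rx|].
        by case: nou; exists x.
      exact: gF.
    pose d := MkAT (sigma_indic (SS _ (sF _ Fu))).
    exists (g + (f u - g u) *: d).
      apply: (closed_idealD iC) => //; apply: (closed_idealZ iC) => J [_ gJ].
      by apply: (gJ u) => //; exact: (sF _ Fu).
    have dE x : (g + (f u - g u) *: d) x = g x + (f u - g u) * \1_[set u] x by [].
    split => [x Fx|x Fx ltxn]; rewrite dE /indic.
      by rewrite memNset ?mulr0 ?addr0 ?gN // => xu; apply: Fx; rewrite xu.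
    have [->|ne] := pselect (x = u); first by rewrite mem_set // mulr1 addrC subrK.
    rewrite memNset // mulr0 addr0 gF //.
    move: ltxn; rewrite ltnS leq_eqVlt => /predU1P[rx|//]; case: ne.
    by apply: rI; rewrite ?inE // rx.
  exists g => //; split=> // x Fx; apply: gF => //; exact: rn.
exists g; first by exists g.
move=> x; have [Fx|Fx] := pselect (F x); last by rewrite gNF // subr0 hF.
by rewrite gF // subrr normr0 lecR ltW.
Qed.

End FunctionAlgebra.

Lemma norm_small_eq0 (R : realType) (z : R[i]) :
  (forall e : R, 0 < e -> `|z| <= e%:C) -> z = 0.
Proof.
move=> hz; apply/eqP/contraT; rewrite -normr_gt0.
have <- : (complex.Re `|z|)%:C = `|z| by rewrite RRe_real ?normr_real.
set r := complex.Re _; rewrite ltcR => r0.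
have := hz (r / 2) (divr_gt0 r0 (ltr0Sn _ 1)).
rewrite -[`|z|]RRe_real ?normr_real // -/r lecR ler_pdivlMr //.
by rewrite mulr_natr mulr2n gerDl leNgt r0.
Qed.

(** * Continuity and values of the induced homomorphism *)

Section Induced.
Variables (R : realType) (T1 T2 : ditree) (alpha : dimorphism T1 T2).
Hypothesis alpha_mono : monomorphism alpha.
Variable alpha_star : {linear AT R T1 -> AT R T2}.
Hypothesis alpha_starP : induced_by alpha alpha_star.
Local Notation av := (mor_vert alpha).
Local Notation ae := (mor_edge alpha).
Implicit Types f g : AT R T1.

(** Evaluating [alpha_star] at [x] is linear and multiplicative, so the bound on characters applies;
    this is the source of continuity. *)
Lemma induced_bounded f (K : R) x : 0 < K -> (forall v, `|f v| <= K%:C) ->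
  `|alpha_star f x| <= (2 * K)%:C.
Proof.
apply: (@character_bounded _ _ (fun g => alpha_star g x)).
- by move=> g h; rewrite linearD.
- by move=> a g; rewrite linearZ.
- by move=> g h; rewrite alpha_starP.1.1.
Qed.

Lemma induced_approx (P : set (AT R T1)) (f : AT R T1) (e : R) :
  sup_closure [set AT_fun g | g in P] f -> 0 < e ->
  exists g, [/\ P g, forall v, `|f v - g v| <= e%:C
    & forall x, `|alpha_star f x - alpha_star g x| <= e%:C].
Proof.
(* Halving [e] absorbs the constant 2 of [induced_bounded]. *)
move=> cf e0; have e2 : 0 < e / 2 by rewrite divr_gt0.
have [_ [g Pg <-] fg] := cf _ e2; exists g; split => // [v|x].
  by rewrite (le_trans (fg v)) // lecR ler_pdivrMr // ler_peMr ?(ltW e0) // ler1n.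
have := @induced_bounded (f - g) _ x e2 fg.
by rewrite linearB mulrC divfK ?pnatr_eq0.
Qed.

Lemma induced_val f m x : VsetF (av m) (range ae) x -> alpha_star f x = f m.
Proof.
move=> mx; move: f; apply: AT_density.
- by rewrite linear0.
- by move=> f g fE gE; rewrite linearD; exact: (congr2 +%R fE gE).
- by move=> a f fE; rewrite linearZ; exact: (congr1 ( *%R a) fE).
- move=> f cf; apply/eqP; rewrite -subr_eq0; apply/eqP/norm_small_eq0 => e e0.
  have [g [gE fg afg]] := induced_approx cf (divr_gt0 e0 (ltr0Sn _ 1)).
  rewrite -[alpha_star f x](subrK (alpha_star g x)) gE -addrA.
  rewrite (le_trans (ler_normD _ _)) // [e]splitr rmorphD lerD // -?gE //.
  by rewrite gE distrC.
- move=> v F f fF sF fE; rewrite (alpha_starP.2 _ _ fF sF _ fE) fE.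
  have h := VsetF_mor alpha_mono v F mx.
  rewrite /indic; congr (_ %:R); congr nat_of_bool.
  by apply/idP/idP => /set_mem/h/mem_set.
Qed.

Lemma induced_valE f v : alpha_star f (av v) = f v.
Proof. by apply: induced_val; exact: VsetF_mor_self. Qed.


Lemma induced_injective : injective alpha_star.
Proof.
by move=> f g fg; apply: val_inj; apply/funext => v; rewrite /= -!induced_valE fg.
Qed.

(** * Pulling [C0 R S2] back along [alpha_star] *)

Section Kernel.
Variable S2 : set (vert T2).
Hypothesis S2_sub : S2 `<=` @Sigma T2.
Let S1 : set (vert T1) :=
  [set v | [/\ Sigma v, S2 (av v) & ae @` Delta1 v = Delta1 (av v)]].

(** The preimage of [C0 R S2] is a closed ideal. For [v] in [S1] the equality of edge sets makes
    [alpha_star] send the indicator of [[set v]], that is of [VsetF v (Delta1 v)], to that of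
    [[set av v]]. *)
Lemma induced_C0 f : C0 R S1 f -> C0 R S2 (alpha_star f).
Proof.
have iC := @closed_ideal_C0 R T2 S2.
have [[aM _] aV] := alpha_starP.
move=> Cf; apply: (Cf [set f | C0 R S2 (alpha_star f)]); split; last first.
  move=> v g [[_ fv] Sv Dv] gE J [_ gJ]; apply: (gJ _ _ Sv).
  by rewrite (aV v _ fv) // ?Dv ?VsetF_Delta1.
split => /=.
- by rewrite linear0; exact: (closed_ideal0 iC).
- by move=> g h hg hh; rewrite linearD; exact: (closed_idealD iC).
- by move=> a g hg; rewrite linearZ; exact: (closed_idealZ iC).
- by move=> g h hh; rewrite aM; exact: (closed_idealMl iC).
- by move=> g h hg; rewrite aM; exact: (closed_idealMr iC).
- move=> g cg; apply: (closed_ideal_closed iC) => e e0.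
  have [h [hh _ gh]] := induced_approx cg e0.
  by exists (AT_fun (alpha_star h)) => //; exists (alpha_star h).
Qed.

(* If an edge at alpha v is missing from alpha(T1), then alpha_star f has the
   constant value f v beyond it; vanishing at infinity is impossible there,
   because every vertex of S2 is the origin of a positive edge. *)
Lemma induced_C0_S1 f v e : C0 R S2 (alpha_star f) -> 0 < e ->
  ~ (`|f v| <= e%:C) -> S1 v.
Proof.
move=> Cf e0 fv; have [F [fF sF hF]] := C0_small Cf e0.
have inF x : VsetF (av v) (range ae) x -> F x.
  by move=> vx; apply: contrapT => /hF; rewrite (induced_val _ vx).
have Sv : S2 (av v) by apply/sF/inF; exact: VsetF_mor_self.
have aD : ae @` Delta1 v = Delta1 (av v).
  apply/seteqP; split=> [_ [a [pa <-] <-]|b [pb ob]].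
    by split; [exact: mor_pos|exact: mor_org].
  apply: contrapT => nb.
  have nrb : ~ range ae b.
    move=> [a _ ab]; apply: nb; exists a => //; split.
      by apply/(mor_posE alpha); rewrite ab.
    by apply: alpha_mono.1; rewrite -mor_org ab.
  have inV q x : is_dpath (ter b) q x -> F x.
    by move=> bx; apply: inF; right; exists b => //; exists q.
  (* Each vertex reached lies in [F], hence in [S2] and in [Sigma], so the path can be prolonged. *)
  have ray n : exists x q, is_dpath (ter b) q x /\ size q = n.
    elim: n => [|n [x [q [bx sq]]]]; first by exists (ter b), [::].
    have [[a [pa oa]] _] := S2_sub (sF _ (inV _ _ bx)).
    exists (ter a), (rcons q a); rewrite size_rcons sq; split => //.
    rewrite -cats1; apply/is_dpath_cat; exists x => //.
    by apply/is_dpath_cons.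
  have [x /choice[q hq]] := choice ray.
  (* The end of a path from [ter b] determines the path, hence its length, which is the index. *)
  have xI : {in setT &, injective x}.
    move=> i j _ _ xij; have [[qi _] <-] := hq i; have [[qj _] <-] := hq j.
    by rewrite xij in qi; rewrite (is_path_unique qi qj).
  apply: infinite_nat; rewrite -(eq_finite_set (inj_card_eq xI)).
  by apply: sub_finite_set fF => _ [i _ <-]; exact: (inV (q i)) (hq i).1.
(* Nonemptiness and finiteness pass from [Delta1 (av v)] back to [Delta1 v] along the injective
   [ae]. *)
split => //; have [[b Db] fD] := S2_sub Sv; move: Db fD; rewrite -aD.
move=> [a Da _] fD; split; first by exists a.
rewrite -(eq_finite_set (inj_card_eq (f := ae) _)) //.
by move=> c d _ _; exact: alpha_mono.2.
Qed.

Lemma C0_induced f : C0 R S2 (alpha_star f) -> C0 R S1 f.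
Proof.
move=> Cf; apply: small_C0 => [v []//|e e0].
have [F [fF sF hF]] := C0_small Cf e0.
(* This set is finite because [av] embeds it into [F]. *)
exists [set v | ~ (`|f v| <= e%:C)]; split; last by move=> v /contrapT.
  rewrite -(eq_finite_set (inj_card_eq (f := av) _)).
    apply: sub_finite_set fF => _ [v fv <-]; apply: contrapT => /hF.
    by rewrite induced_valE.
  by move=> c d _ _; exact: alpha_mono.1.
by move=> v; exact: induced_C0_S1.
Qed.

End Kernel.
End Induced.

(** * The induced map of quotients *)

Theorem lemma1p20 (R : realType) (T1 T2 : ditree) (alpha : dimorphism T1 T2)
    (alpha_mono : monomorphism alpha)
    (alpha_star : {linear AT R T1 -> AT R T2})
    (alpha_starP : induced_by alpha alpha_star)
    (S2 : set (vert T2)) (S2_sub : S2 `<=` @Sigma T2) :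
  let S1 : set (vert T1) :=
    [set v | [/\ Sigma v, S2 (mor_vert alpha v)
      & mor_edge alpha @` Delta1 v = Delta1 (mor_vert alpha v)]] in
  let pi1 := ATS_proj R S1 in
  let pi2 := ATS_proj R S2 in
  [set f | pi2 (alpha_star f) = 0] = C0 R S1 /\
  exists beta : {linear ATS R S1 -> ATS R S2},
    [/\ star_hom beta,
        forall f : AT R T1, beta (pi1 f) = pi2 (alpha_star f),
        set_surj setT setT pi1 /\ set_surj setT setT pi2
      & injective alpha_star /\ injective beta].
Proof.
move=> S1 pi1 pi2.
(* From right to left this makes the bottom row well defined; from left to right it makes it
   injective. *)
have C0E f : C0 R S2 (alpha_star f) <-> C0 R S1 f.
  by split; [exact: C0_induced|exact: induced_C0].
have projK (x : ATS R S1) : pi1 (repr x) = x by exact: ATS_projK.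
split.
  apply/seteqP; split => f /=.
    rewrite -[X in _ = X](linear0 pi2) => /ATS_projP; rewrite subr0.
    by move/C0E.
  move/C0E => Cf; rewrite -[RHS](linear0 pi2); apply/ATS_projP.
  by rewrite subr0.
pose b (x : ATS R S1) : ATS R S2 := pi2 (alpha_star (repr x)).
have bE f : b (pi1 f) = pi2 (alpha_star f).
  apply/ATS_projP; rewrite -linearB; apply/C0E.
  by apply/ATS_projP; exact: projK.
have ind (P : ATS R S1 -> Prop) : (forall f, P (pi1 f)) -> forall x, P x.
  by move=> h x; rewrite -(projK x).
have b_lin : linear b.
  by move=> a; elim/ind=> f; elim/ind=> g; rewrite -linearP !bE linearP; exact: linearP.
pose beta : {linear ATS R S1 -> ATS R S2} :=
  HB.pack b (GRing.isLinear.Build _ _ _ _ b b_lin).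
have [[aM aS] _] := alpha_starP.
have [pi1M pi1S] := @ATS_proj_star_hom R T1 S1.
have [pi2M pi2S] := @ATS_proj_star_hom R T2 S2.
exists beta; split => //.
- split; first by elim/ind=> f; elim/ind=> g; rewrite -pi1M /= !bE aM; exact: pi2M.
  by elim/ind=> f; rewrite -pi1S /= !bE aS; exact: pi2S.
- by split=> x _; exists (repr x) => //; exact: ATS_projK.
split; first exact: (induced_injective alpha_mono alpha_starP).
elim/ind=> f; elim/ind=> g; rewrite /= !bE => /ATS_projP.
by rewrite -linearB => /C0E h; apply/ATS_projP.
Qed.
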